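(* Let $V\subseteq k[x]$ be a $k$-linear subspace containing the ideal $I=(f_1(x_1),\dots,f_n(x_n))$, and let $r=\dim_k k[x]/V$. Let $\mathfrak{L}=(L_1,\dots,L_r):k[x]\to k^r$ be a surjective $k$-linear map with $\ker\mathfrak{L}=V$, where each $L_i$ is written in the form $$L_i=\sum_{\lambda\in\Lambda}S_\lambda\circ P^{(i)}_\lambda(D)$$ with $P^{(i)}_\lambda\in k[x]$ and $\operatorname{Deg}P^{(i)}_\lambda<m(\lambda)$ for all $\lambda\in\Lambda$. Let $\Lambda_0=\{\lambda\in\Lambda : g_\lambda\in V\}$. Then $V$ is an MZ-space of $k[x]$ if and only if the following two properties hold: (i) for each $\Lambda'\subseteq\Lambda$ such that $\Lambda'\setminus\Lambda_0\neq\emptyset$ there exists an $i\in\{1,\dots,r\}$ such that $$\sum_{\lambda\in\Lambda'\setminus\Lambda_0}P^{(i)}_\lambda(0)\neq 0;$$ (ii) for each non-empty $\Lambda'\subseteq\Lambda$ and all $1\le i\le r$, $L_i\big(\sum_{\lambda\in\Lambda'\cap\Lambda_0}k[x]g_\lambda\big)=0$ (i.e. $L_i$ vanishes on this ideal).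
   Context: $k$ is an algebraically closed field of characteristic zero and $k[x]=k[x_1,\dots,x_n]$ is the polynomial ring in $n$ variables. MZ-space: for a $k$-algebra $R$, a $k$-linear subspace $M\subseteq R$ is a (left) MZ-space (Mathieu-Zhao space) of $R$ if: whenever $a\in R$ is such that $a^m\in M$ for all large $m$ (i.e. there is $N$ with $a^m\in M$ for all $m\ge N$), then for every $b\in R$ also $ba^m\in M$ for all large $m$. For each $i=1,\dots,n$, $f_i(x_i)\in k[x_i]$ is a monic univariate polynomial of positive degree $d_i$, $\Lambda_i\subset k$ is the set of distinct zeros of $f_i$, and for $\lambda_i\in\Lambda_i$, $m(\lambda_i)$ is its multiplicity, so $f_i(x_i)=\prod_{\lambda_i\in\Lambda_i}(x_i-\lambda_i)^{m(\lambda_i)}$. It is assumed that $0\notin\Lambda_i$ for all $i$. Put $\Lambda=\Lambda_1\times\cdots\times\Lambda_n$, and for $\lambda=(\lambda_1,\dots,\lambda_n)\in\Lambda$ put $m(\lambda)=(m(\lambda_1),\dots,m(\lambda_n))$ and $[(x-\lambda)]^{m(\lambda)}=((x_1-\lambda_1)^{m(\lambda_1)},\dots,(x_n-\lambda_n)^{m(\lambda_n)})$, an ideal of $k[x]$. By the Chinese remainder theorem $k[x]/I\simeq\prod_{\lambda\in\Lambda}k[x]/[(x-\lambda)]^{m(\lambda)}$. For each $\lambda\in\Lambda$, $g_\lambda\in k[x]$ is a fixed polynomial whose class $g_\lambda+I$ corresponds to the idempotent with $1$ in the component indexed by $\lambda$ and $0$ elsewhere; that is, $g_\lambda\equiv 1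 \bmod [(x-\lambda)]^{m(\lambda)}$ and $g_\lambda\in[(x-\mu)]^{m(\mu)}$ for all $\mu\in\Lambda$, $\mu\ne\lambda$. $\operatorname{Deg}f=(\deg_{x_1}f,\dots,\deg_{x_n}f)$, and for $a,b\in\mathbb{Z}^n$, $a<b$ means $a_i<b_i$ for all $i$; thus $\operatorname{Deg}P<m(\lambda)$ means every monomial $x_1^{i_1}\cdots x_n^{i_n}$ occurring in $P$ satisfies $i_j<m(\lambda_j)$ for all $j$ (in particular $P=0$ is allowed). $D_j=x_j\,\partial/\partial x_j$ acting on $k[x]$, $D=(D_1,\dots,D_n)$, and $P(D)$ is the operator obtained by substituting the commuting operators $D_j$ for $x_j$ in $P$. $S_\lambda:k[x]\to k$ is the substitution map $S_\lambda(g)=g(\lambda)$. Empty sums of ideals are $0$. *)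

(* Defs.v *)
From HB Require Import structures.
From mathcomp Require Import all_boot all_order all_algebra.
From mathcomp Require Import finmap.
From mathcomp Require Import mpoly.

Set Implicit Arguments.
Unset Strict Implicit.
Unset Printing Implicit Defensive.

Import GRing.Theory.
Local Open Scope ring_scope.
Local Open Scope fset_scope.

Definition MZ_space (k : fieldType) (R : algType k) (M : {pred R}) : Prop :=
  submod_closed M /\
  forall a : R,
    (exists N : nat, forall m : nat, (N <= m)%N -> a ^+ m \in M) ->
    forall b : R,
      exists N : nat, forall m : nat, (N <= m)%N -> b * a ^+ m \in M.

Definition ideal_gen (R : comNzRingType) (J : finType) (F : J -> R) (p : R)
    : Prop :=
  exists h : J -> R, p = \sum_(j : J) h j * F j.

(* [dim (W / V) = r]: there are r vectors whose classes form a basis of W / V *)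
Definition quotient_dim (k : fieldType) (W : lmodType k) (V : {pred W})
    (r : nat) : Prop :=
  exists b : 'I_r -> W,
    forall p : W, exists! c : 'rV[k]_r, p - \sum_(i < r) c 0 i *: b i \in V.

(* Only meaningful for p != 0 *)
Definition zeros (k : closedFieldType) (p : {poly k}) : {fset k} :=
  [fset z in sval (closed_field_poly_normal p)].

Lemma in_zeros (k : closedFieldType) (p : {poly k}) (z : k) :
  p != 0 -> (z \in zeros p) = root p z.
Proof.
move=> p0; rewrite in_fset /=.
case: (closed_field_poly_normal p) => s /= Dp; rewrite Dp.
by rewrite rootZ ?lead_coef_eq0 // root_prod_XsubC.
Qed.

Section Points.
Variables (k : closedFieldType) (n : nat) (f : 'I_n -> {poly k}).

Definition zero_grid : {fset {ffun 'I_n -> k}} :=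
  [fset [ffun i => val (u i)] |
     u : {dffun forall i : 'I_n, zeros (f i)} in predT].

Lemma in_zero_grid (lam : {ffun 'I_n -> k}) :
  (lam \in zero_grid) = [forall i, lam i \in zeros (f i)].
Proof.
apply/imfsetP/forallP => [[u _ ->] i|H]; first by rewrite ffunE; apply: valP.
exists [ffun i : 'I_n => [` H i] : zeros (f i)] => //.
by apply/ffunP => i; rewrite !ffunE.
Qed.

(* f_i(x_i) as an element of k[x_1, .., x_n] *)
Definition in_var (i : 'I_n) : {mpoly k[n]} :=
  (map_poly (@mpolyC n k) (f i)).['X_i].

Definition mult (lam : {ffun 'I_n -> k}) (j : 'I_n) : nat :=
  mup (lam j) (f j).

Definition local_ideal (lam : {ffun 'I_n -> k}) : {mpoly k[n]} -> Prop :=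
  ideal_gen (fun j : 'I_n => ('X_j - (lam j)%:MP) ^+ mult lam j).

Definition Deg_lt (P : {mpoly k[n]}) (d : 'I_n -> nat) : Prop :=
  forall m : 'X_{1..n}, m \in msupp P -> forall j : 'I_n, (m j < d j)%N.
End Points.

Section DiffOp.
Variables (k : fieldType) (n : nat).

Definition euler (j : 'I_n) (p : {mpoly k[n]}) : {mpoly k[n]} :=
  'X_j * p^`M(j).

(* D_1^{m_1} .. D_n^{m_n} *)
Definition eulerm (m : 'X_{1..n}) (p : {mpoly k[n]}) : {mpoly k[n]} :=
  foldr (fun j => iter (m j) (euler j)) p (enum 'I_n).

Definition euler_op (P p : {mpoly k[n]}) : {mpoly k[n]} :=
  \sum_(m <- msupp P) P@_m *: eulerm m p.
End DiffOp.

(* Main.v *)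
(* Modulo I the algebra k[x] is finite dimensional, with orthogonal idempotents
   g_lam.  If a^m lies in V for all large m, then the idempotent e supported on
   the lam with a(lam) <> 0 is, modulo I, a combination of high powers of a,
   while a^m (1 - e) lies in I for large m.  Hence V is an MZ-space if and only
   if every sum of g_lam's lying in V generates an ideal contained in V.  The
   operators P(D) with Deg P < m(lam) kill the local ideal at lam under S_lam,
   so L_i(g_lam) = P_lam^(i)(0), which turns (i) and (ii) into this criterion. *)
Require Import Defs.
From HB Require Import structures.
From mathcomp Require Import all_boot all_order all_algebra.
From mathcomp Require Import finmap.
From mathcomp Require Import mpoly.
From mathcomp Require Import zify ring.

Set Implicit Arguments.
Unset Strict Implicit.
Unset Printing Implicit Defensive.

Import GRing.Theory.
Local Open Scope ring_scope.

(** * Ideals as predicates, and nilpotency modulo an ideal *)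

Definition is_ideal (R : comNzRingType) (K : R -> Prop) : Prop :=
  [/\ K 0, forall p q, K p -> K q -> K (p + q) & forall h p, K p -> K (h * p)].

Section Ideals.
Variable R : comNzRingType.
Implicit Types (K : R -> Prop) (p q a : R).

Lemma ideal_gen_ideal (J : finType) (F : J -> R) : is_ideal (ideal_gen F).
Proof.
split.
- by exists (fun=> 0); rewrite big1 // => j _; rewrite mul0r.
- move=> p q [h ->] [h' ->]; exists (fun j => h j + h' j).
  by rewrite -big_split; apply: eq_bigr => j _; rewrite mulrDl.
- move=> c p [h ->]; exists (fun j => c * h j).
  by rewrite mulr_sumr; apply: eq_bigr => j _; rewrite mulrA.
Qed.

Lemma ideal_gen_mem (J : finType) (F : J -> R) j : ideal_gen F (F j).
Proof.
exists (fun i => (i == j)%:R).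
by rewrite (bigD1 j) //= eqxx mul1r big1 ?addr0 // => i /negPf ->; rewrite mul0r.
Qed.

Lemma ideal_gen_min (J : finType) (F : J -> R) K p :
  is_ideal K -> (forall j, K (F j)) -> ideal_gen F p -> K p.
Proof. by move=> [K0 KD KM] KF [h ->]; elim/big_ind: _ => // j _; apply: KM. Qed.

Lemma ideal_gen_sub (J J' : finType) (F : J -> R) (F' : J' -> R) p :
  (forall j, ideal_gen F' (F j)) -> ideal_gen F p -> ideal_gen F' p.
Proof. by apply: ideal_gen_min; apply: ideal_gen_ideal. Qed.

Variables (K : R -> Prop) (idK : is_ideal K).

Lemma ideal0 : K 0. Proof. by case: idK. Qed.

Lemma idealD p q : K p -> K q -> K (p + q).
Proof. by case: idK => _ + _; apply. Qed.

Lemma idealM p q : K q -> K (p * q).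
Proof. by case: idK => _ _; apply. Qed.

Lemma idealMr p q : K p -> K (p * q).
Proof. by rewrite mulrC; apply: idealM. Qed.

Lemma idealN p : K p -> K (- p).
Proof. by rewrite -mulN1r; apply: idealM. Qed.

Lemma ideal_sum (I : eqType) (s : seq I) (F : I -> R) :
  (forall i, i \in s -> K (F i)) -> K (\sum_(i <- s) F i).
Proof.
move=> KF; rewrite big_seq; apply: (big_ind K) => [|p q|i]; last exact: KF.
- exact: ideal0.
- exact: idealD.
Qed.

Lemma idealX_leq a M m : K (a ^+ M) -> (M <= m)%N -> K (a ^+ m).
Proof. by move=> KM /subnK <-; rewrite exprD; apply: idealM. Qed.

Definition nilpotent_mod a := exists M : nat, K (a ^+ M).

(** In the binomial expansion of [(a + b) ^+ (M + N)], every term has exponent at least [N] in [b]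
    or at least [M] in [a]. *)
Lemma nilpotent_modD a b :
  nilpotent_mod a -> nilpotent_mod b -> nilpotent_mod (a + b).
Proof.
move=> [M KM] [N KN]; exists (M + N)%N; rewrite exprDn.
apply: ideal_sum => i _; rewrite -mulr_natl; apply: idealM.
have [le_Ni|lt_iN] := leqP N i; first by apply: idealM; apply: idealX_leq KN _.
by apply: idealMr; apply: idealX_leq KM _; rewrite leq_subRL; lia.
Qed.

Lemma nilpotent_modM a b : nilpotent_mod b -> nilpotent_mod (a * b).
Proof. by move=> [M KM]; exists M; rewrite exprMn; apply: idealM. Qed.

Lemma nilpotent_mod0 : nilpotent_mod 0.
Proof. by exists 1; rewrite expr1; exact: ideal0. Qed.

End Ideals.

Lemma max_bound (T : eqType) (s : seq T) (Q : T -> nat -> Prop) :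
  (forall x m m', Q x m -> (m <= m')%N -> Q x m') ->
  (forall x, x \in s -> exists m, Q x m) ->
  exists M, forall x, x \in s -> Q x M.
Proof.
move=> mono; elim: s => [|x s IHs] ex_m; first by exists 0%N.
have [M1 Q1] := IHs (fun y ys => ex_m y (mem_behead (s := x :: s) ys)).
have [M2 Q2] := ex_m x (mem_head x s).
exists (maxn M1 M2) => y; rewrite inE => /predU1P[->|/Q1 Qy].
  by apply: mono Q2 _; exact: leq_maxr.
by apply: mono Qy _; exact: leq_maxl.
Qed.

(** * Gcds and cofactors of univariate polynomials *)

Section Bezout.
Variable k : fieldType.

Lemma poly_ideal_gcd (K : {poly k} -> Prop) (I : eqType) (s : seq I)
    (F : I -> {poly k}) :
  is_ideal K -> (forall z, z \in s -> K (F z)) ->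
  exists2 d, K d & forall z, z \in s -> d %| F z.
Proof.
move=> idK; elim: s => [|z s IHs] KF; first by exists 0 => //; exact: ideal0.
have [d Kd dvd_d] := IHs (fun y ys => KF y (mem_behead (s := z :: s) ys)).
have [[u v] /= /eqpP[[c1 c2] /andP[/= nz1 nz2] Duv]] := Bezoutp d (F z).
exists (gcdp d (F z)) => [|y].
  (* [Bezoutp] yields the gcd only up to a nonzero scalar; [c1 / c2] corrects this. *)
  have ->: gcdp d (F z) = (c1 / c2)%:P * (u * d + v * F z).
    by rewrite mul_polyC mulrC -scalerA Duv scalerA mulVf ?scale1r.
  apply: (idealM idK); apply: (idealD idK); apply: (idealM idK) => //.
  exact/KF/mem_head.
rewrite inE => /predU1P[->|ys]; first exact: dvdp_gcdr.
exact: dvdp_trans (dvdp_gcdl _ _) (dvd_d _ ys).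
Qed.

Definition cofactor_at (p : {poly k}) (z : k) : {poly k} :=
  p %/ ('X - z%:P) ^+ mup z p.

Lemma cofactor_atK p z : p != 0 ->
  ('X - z%:P) ^+ mup z p * cofactor_at p z = p.
Proof. by move=> p0; rewrite mulrC divpK // -mup_geq. Qed.

(** A root of the cofactor at [z] would give one more factor ['X - z%:P] of [p] than its
    multiplicity allows. *)
Lemma cofactor_at_nroot p z : p != 0 -> ~~ root (cofactor_at p z) z.
Proof.
move=> p0; rewrite -dvdp_XsubCl; apply/negP => /dvdpP[q Dq].
have := mup_leq z (mup z p) p0; rewrite leqnn => /esym/negP; apply.
by rewrite -{2}(cofactor_atK z p0) exprSr dvdp_mul2l
   ?expf_neq0 ?polyXsubC_eq0 // Dq dvdp_mull.
Qed.

End Bezout.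

(** A common divisor [d] of the cofactors that lies in [K] divides [p], so each root of [d] is a
    root [z] of [p]; but the cofactor at [z] does not vanish there. Having no root in an
    algebraically closed field, [d] is a nonzero constant. *)
Lemma cofactors_comaximal (k : closedFieldType) (p : {poly k})
    (K : {poly k} -> Prop) :
  (1 < size p)%N -> is_ideal K ->
  (forall z, root p z -> K (cofactor_at p z)) -> K 1.
Proof.
move=> p_gt1 idK KF; have p0: p != 0 by rewrite -size_poly_gt0 ltnW.
have rootE z: (z \in zeros p) = root p z by exact: in_zeros.
have [d Kd dvd_d] : exists2 d, K d &
    forall z, z \in (zeros p : seq k) -> d %| cofactor_at p z.
  by apply: poly_ideal_gcd => // z; rewrite rootE; exact: KF.
have [w pw] : exists w, root p w by apply/closed_rootP; rewrite neq_ltn p_gt1 orbT.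
have d_nroot z : root p z -> ~~ root d z.
  move=> pz; apply: contra (cofactor_at_nroot z p0).
  by rewrite -!dvdp_XsubCl => /dvdp_trans; apply; apply: dvd_d; rewrite rootE.
have d_root z : root d z -> root p z.
  rewrite -!dvdp_XsubCl => /dvdp_trans; apply.
  apply: dvdp_trans (dvd_d w _) _; first by rewrite rootE.
  by rewrite -{2}(cofactor_atK w p0) dvdp_mull.
have /size_poly1P[c nz_c Dd] : size d == 1.
  apply/negPn/negP => /closed_rootP[z dz].
  by have := d_nroot _ (d_root _ dz); rewrite dz.
have ->: 1 = c^-1%:P * d by rewrite Dd -polyCM mulVf.
exact: (idealM idK).
Qed.

(** * Ideals of powers at a point and the operators P(D) *)

Section PointIdeals.
Variables (k : closedFieldType) (n : nat) (mu : 'I_n -> k).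
Implicit Types (d : 'I_n -> nat) (p q : {mpoly k[n]}).

Definition powers_ideal d : {mpoly k[n]} -> Prop :=
  ideal_gen (fun j : 'I_n => ('X_j - (mu j)%:MP) ^+ d j).

Lemma powers_ideal_mem d j m :
  (d j <= m)%N -> powers_ideal d (('X_j - (mu j)%:MP) ^+ m).
Proof.
move=> le_m; apply: (idealX_leq (ideal_gen_ideal _)) le_m.
exact: (ideal_gen_mem (fun j : 'I_n => ('X_j - (mu j)%:MP) ^+ d j)).
Qed.

Lemma powers_ideal_meval d p :
  (forall j, 0 < d j)%N -> powers_ideal d p -> p.@[mu] = 0.
Proof.
move=> d_gt0 [h ->]; rewrite raddf_sum big1 // => j _ /=.
by rewrite mevalM rmorphXn /= mevalB mevalXU mevalC subrr expr0n gtn_eqF ?mulr0.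
Qed.

(** The polynomials [q] for which [q - q.@[mu]%:MP] is nilpotent modulo the ideal are closed under
    sums and products, and include the constants and the variables. *)
Lemma nilpotent_at_zero d p : p.@[mu] = 0 -> nilpotent_mod (powers_ideal d) p.
Proof.
have idK : is_ideal (powers_ideal d) by exact: ideal_gen_ideal.
pose T q := nilpotent_mod (powers_ideal d) (q - q.@[mu]%:MP).
have TC c : T c%:MP by rewrite /T mevalC subrr; exact: nilpotent_mod0.
have TD q1 q2 : T q1 -> T q2 -> T (q1 + q2).
  by rewrite /T mevalD mpolyCD opprD addrACA; exact: nilpotent_modD.
have TM q1 q2 : T q1 -> T q2 -> T (q1 * q2).
  rewrite /T => T1 T2.
  have ->: q1 * q2 - (q1 * q2).@[mu]%:MP
      = q1 * (q2 - q2.@[mu]%:MP) + q2.@[mu]%:MP * (q1 - q1.@[mu]%:MP).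
    by rewrite mevalM mpolyCM; ring.
  by apply: nilpotent_modD => //; apply: nilpotent_modM.
suff Tp : T p by move=> p0; move: Tp; rewrite /T p0 subr0.
rewrite [p]mpolyE; apply: (big_ind T) => [||m _]; [exact: (TC 0) | exact: TD |].
rewrite -mul_mpolyC; apply: (TM); first exact: TC.
rewrite mpolyXE_id; apply: (big_ind T) => [||i _]; [exact: (TC 1) | exact: TM |].
elim: (m i) => [|e IHe]; first exact: (TC 1).
rewrite exprS; apply: (TM) IHe.
by exists (d i); rewrite mevalXU; apply: powers_ideal_mem.
Qed.

Lemma mderiv_exp i q m : (q ^+ m)^`M(i) = q ^+ m.-1 * q^`M(i) *+ m.
Proof.
elim: m => [|[|m] IHm]; first by rewrite mderivC mulr0n.
  by rewrite !expr1 expr0 mul1r mulr1n.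
by rewrite exprS mderivM IHm /= mulrnAr mulrA -exprS
  [q^`M(i) * _]mulrC -mulrS.
Qed.

(** By the product rule, only the generator in the variable [i] loses an exponent, and it loses at
    most one. Asking just for a bound on [d'] avoids rewriting exponent functions in the inductions
    below. *)
Lemma euler_powers_ideal i d d' p :
  (forall j, d' j <= d j - (j == i))%N -> powers_ideal d p ->
  powers_ideal d' (euler i p).
Proof.
have idK : is_ideal (powers_ideal d') by exact: ideal_gen_ideal.
move=> le_d' [h ->]; rewrite /euler raddf_sum mulr_sumr /=.
apply: (ideal_sum idK) => j _; apply: (idealM idK).
rewrite mderivM; have := le_d' j => le_j.
apply: (idealD idK); apply: (idealM idK).
  by apply: powers_ideal_mem; apply: leq_trans le_j (leq_subr _ _).
rewrite mderiv_exp; case: (eqVneq j i) le_j => [-> | ne_ji] le_j.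
  rewrite -mulrnAr; apply: (idealMr idK); apply: powers_ideal_mem.
  by rewrite -subn1.
rewrite mderivB mderivC mderivX mnm1E (negPf ne_ji) scale0r subr0 mulr0 mul0rn.
exact: (ideal0 idK).
Qed.

(** Stated for an arbitrary list so that induction applies; each occurrence of [j] in [s] costs at
    most [m j]. In [enum 'I_n] every index occurs once. *)
Lemma foldr_euler_powers_ideal (m : 'X_{1..n}) (s : seq 'I_n) d p :
  powers_ideal d p ->
  powers_ideal (fun j => d j - count_mem j s * m j)%N
    (foldr (fun j => iter (m j) (euler j)) p s).
Proof.
move=> dp; elim: s => [|i s IHs] /=.
  by apply: ideal_gen_sub dp => j; apply: powers_ideal_mem; exact: leq_subr.
have step e : powers_ideal
    (fun j => d j - count_mem j s * m j - (j == i) * e)%N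
    (iter e (euler i) (foldr (fun j => iter (m j) (euler j)) p s)).
  elim: e => [|e IHe] /=; last by apply: euler_powers_ideal IHe => j;
    rewrite mulnSr subnDA.
  by apply: ideal_gen_sub IHs => j; apply: powers_ideal_mem; exact: leq_subr.
apply: ideal_gen_sub (step (m i)) => j; apply: powers_ideal_mem.
by rewrite mulnDl subnDA subnAC; case: (eqVneq i j) => [->|_]; rewrite ?leqnn.
Qed.

(** The exponents [d j - m j] that remain are positive, so all generators still vanish at [mu]. *)
Lemma eulerm_powers_ideal (m : 'X_{1..n}) d p :
  (forall j, m j < d j)%N -> powers_ideal d p -> (eulerm m p).@[mu] = 0.
Proof.
move=> lt_m /(foldr_euler_powers_ideal m (enum 'I_n)).
apply: powers_ideal_meval => j.
by rewrite count_uniq_mem ?enum_uniq // mem_enum mul1n subn_gt0.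
Qed.

Lemma euler_op_powers_ideal (P : {mpoly k[n]}) d p :
  Deg_lt P d -> powers_ideal d p -> (euler_op P p).@[mu] = 0.
Proof.
move=> degP dp; rewrite /euler_op raddf_sum big_seq big1 // => m Pm /=.
by rewrite mevalZ (eulerm_powers_ideal (degP m Pm) dp) mulr0.
Qed.

Lemma eulermD (m : 'X_{1..n}) p q : eulerm m (p + q) = eulerm m p + eulerm m q.
Proof.
rewrite /eulerm; elim: (enum 'I_n) => //= i s ->.
by elim: (m i) => //= e ->; rewrite /euler mderivD mulrDr.
Qed.

Lemma euler_opD (P p q : {mpoly k[n]}) :
  euler_op P (p + q) = euler_op P p + euler_op P q.
Proof.
by rewrite -big_split; apply: eq_bigr => m _; rewrite eulermD scalerDr.
Qed.

(** Euler operators kill constants, so the result is 1 if [m] is zero and 0 otherwise. The product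
    of powers of 0 is the value of the monomial [m] at the origin, the form in which [P] evaluated
    at 0 appears next. *)
Lemma eulerm1 (m : 'X_{1..n}) : eulerm m 1 = (\prod_i 0 ^+ m i)%:MP :> {mpoly k[n]}.
Proof.
suff E s : foldr (fun j => iter (m j) (euler j)) 1 s
    = (\prod_(i <- s) 0 ^+ m i)%:MP :> {mpoly k[n]}.
  by rewrite /eulerm E big_enum.
elim: s => [|i s /= ->]; first by rewrite big_nil.
rewrite big_cons; move: (\prod_(j <- s) _) => c.
elim: (m i) => [|e IHe] /=; first by rewrite mul1r.
by rewrite IHe /euler mderivC mulr0 exprS !mul0r.
Qed.

Lemma euler_op1 (P : {mpoly k[n]}) :
  (euler_op P 1).@[mu] = P.@[fun=> 0].
Proof.
rewrite [in RHS]mevalE /euler_op raddf_sum; apply: eq_bigr => m _ /=.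
by rewrite mevalZ eulerm1 mevalC.
Qed.

(** The difference [p - 1] contributes nothing at [mu], which leaves the value on the constant 1.
    Applied to [g lam], this links the functionals to the constant terms in (i). *)
Lemma euler_op_local_unit (P : {mpoly k[n]}) d p :
  Deg_lt P d -> powers_ideal d (p - 1) ->
  (euler_op P p).@[mu] = P.@[fun=> 0].
Proof.
move=> degP d_p1; rewrite -[p](subrK 1) euler_opD mevalD euler_op1.
by rewrite (euler_op_powers_ideal degP d_p1) add0r.
Qed.

End PointIdeals.

(** * The grid of zeros and the Chinese remainder theorem *)

Section Grid.
Variables (k : closedFieldType) (n : nat) (f : 'I_n -> {poly k}).
Hypothesis f_gt1 : forall i, (1 < size (f i))%N.
Implicit Types (lam mu : {ffun 'I_n -> k}) (p q : {mpoly k[n]}).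

Let f_neq0 i : f i != 0.
Proof. by rewrite -size_poly_gt0 ltnW. Qed.

Lemma grid_root lam : (lam \in zero_grid f) = [forall i, root (f i) (lam i)].
Proof. by rewrite in_zero_grid; apply: eq_forallb => i; rewrite in_zeros. Qed.

Lemma grid_inhabited : exists lam, lam \in zero_grid f.
Proof.
have ex_root i : exists z, root (f i) z.
  by apply/closed_rootP; rewrite neq_ltn f_gt1 orbT.
exists [ffun i => sval (sigW (ex_root i))]; rewrite grid_root.
by apply/forallP => i; rewrite ffunE; case: (sigW _).
Qed.

Lemma in_varE i : in_var f i = horner_alg 'X_i (f i).
Proof.
apply: (congr1 (fun q : {poly {mpoly k[n]}} => q.['X_i])); apply: eq_map_poly => c.
by rewrite /= -mul_mpolyC mulr1.
Qed.

(* Multiplying by the cofactors f_j / (x_j - lam_j)^m(lam_j) sends the local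
   ideal at lam into I; they are then removed one variable at a time, since for
   fixed j the cofactors at the zeros of f_j generate the unit ideal. *)
Lemma ideal_of_local_ideals p :
  (forall lam, lam \in zero_grid f -> local_ideal f lam p) ->
  ideal_gen (in_var f) p.
Proof.
set I := ideal_gen (in_var f); move=> loc_p.
have idI : is_ideal I by exact: ideal_gen_ideal.
pose cof lam j := horner_alg ('X_j : {mpoly k[n]}) (cofactor_at (f j) (lam j)).
have: forall lam, lam \in zero_grid f -> I (\prod_(j <- enum 'I_n) cof lam j * p).
  move=> lam in_lam; pose K q := I (\prod_(j <- enum 'I_n) cof lam j * q).
  apply: (@ideal_gen_min _ _ _ K _ _ _ (loc_p _ in_lam)).
    split=> [|q1 q2 K1 K2|h q Kq]; rewrite /K.
    - by rewrite mulr0; exact: (ideal0 idI).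
    - by rewrite mulrDr; exact: (idealD idI).
    - by rewrite mulrCA; exact: (idealM idI).
  move=> j; rewrite /K big_enum (bigD1 j) //= mulrAC; apply: (idealMr idI).
  suff ->: cof lam j * ('X_j - (lam j)%:MP) ^+ mult f lam j = in_var f j.
    exact: ideal_gen_mem.
  rewrite in_varE -[in RHS](cofactor_atK (lam j) (f_neq0 j)) mulrC rmorphM rmorphXn /=.
  by rewrite rmorphB /= horner_algX horner_algC -mul_mpolyC mulr1.
elim: (enum 'I_n) (enum_uniq 'I_n) => [_|j s IHs /= /andP[j_s uniq_s]] Is.
  (* Once all cofactors are removed, the hypothesis still quantifies over grid points, so one must
     exist. *)
  by have [lam /Is] := grid_inhabited; rewrite big_nil mul1r.
apply: IHs => // lam in_lam; set q := _ * p.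
pose K (u : {poly k}) := I (horner_alg 'X_j u * q).
suff: K 1 by rewrite /K rmorph1 mul1r.
apply: (cofactors_comaximal (f_gt1 j)).
  split=> [|u v Ku Kv|u v Kv]; rewrite /K.
  - by rewrite rmorph0 mul0r; exact: (ideal0 idI).
  - by rewrite rmorphD mulrDl; exact: (idealD idI).
  - by rewrite rmorphM -mulrA; exact: (idealM idI).
(* Replacing the coordinate [j] by another zero of [f j] stays in the grid and, as [j] is not in
   [s], changes no other remaining cofactor. *)
move=> z fz; pose lam' := [ffun i => if i == j then z else lam i].
have /Is : lam' \in zero_grid f.
  rewrite grid_root; apply/forallP => i; rewrite ffunE.
  case: eqP => [-> // | _].
  by move: in_lam; rewrite grid_root => /forallP.
have Dj : cof lam' j = horner_alg 'X_j (cofactor_at (f j) z).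
  by rewrite /cof ffunE eqxx.
have Ds : \prod_(i <- s) cof lam' i = \prod_(i <- s) cof lam i.
  apply: eq_big_seq => i s_i; rewrite /cof ffunE.
  by case: eqP s_i j_s => // -> ->.
by rewrite big_cons Dj Ds -mulrA.
Qed.

(** * Idempotents modulo I and the criterion for MZ-spaces *)

Section Idempotents.
Variable g : {ffun 'I_n -> k} -> {mpoly k[n]}.
Hypothesis g_at : forall lam, lam \in zero_grid f -> local_ideal f lam (g lam - 1).
Hypothesis g_off : forall lam mu, lam \in zero_grid f -> mu \in zero_grid f ->
  mu != lam -> local_ideal f mu (g lam).

Let idJ lam : is_ideal (local_ideal f lam).
Proof. exact: ideal_gen_ideal. Qed.

(** For [S] inside the grid, this represents the idempotent of k[x]/I that is 1 on the components in
    [S] and 0 on the others. *)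
Definition idem (S : {fset {ffun 'I_n -> k}}) : {mpoly k[n]} :=
  \sum_(lam <- S) g lam.

Lemma idem_split (S T : {fset {ffun 'I_n -> k}}) :
  idem S = idem (S `&` T)%fset + idem (S `\` T)%fset.
Proof.
rewrite /idem (big_fsetID _ (mem T)) /=; congr (_ + _); apply: eq_fbigl => lam.
  by rewrite !inE.
by rewrite !inE andbC.
Qed.

Section Subset.
Variable S : {fset {ffun 'I_n -> k}}.
Hypothesis sub_S : (S `<=` zero_grid f)%fset.

Lemma idem_off mu : mu \in zero_grid f -> mu \notin S -> local_ideal f mu (idem S).
Proof.
move=> in_mu S_mu; apply: (ideal_sum (idJ mu)) => lam S_lam.
apply: g_off in_mu _; first exact: (fsubsetP sub_S).
by apply: contraNneq S_mu => ->.
Qed.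

Lemma idem_at mu : mu \in S -> local_ideal f mu (idem S - 1).
Proof.
move=> S_mu; have in_mu := fsubsetP sub_S _ S_mu.
rewrite /idem (big_fsetD1 mu) //= addrAC; apply: (idealD (idJ mu)).
  exact: g_at.
apply: (ideal_sum (idJ mu)) => lam; rewrite !inE => /andP[ne_lam S_lam].
by apply: g_off in_mu _; [exact: (fsubsetP sub_S) | rewrite eq_sym].
Qed.

Lemma idemX m : ideal_gen (in_var f) (idem S ^+ m.+1 - idem S).
Proof.
apply: ideal_of_local_ideals => mu in_mu.
have ->: idem S ^+ m.+1 - idem S = idem S * (idem S ^+ m - 1).
  by rewrite mulrBr mulr1 -exprS.
have [S_mu|S_mu] := boolP (mu \in S).
  by apply: (idealM (idJ mu)); rewrite subrX1; apply: (idealMr (idJ mu));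
    exact: idem_at.
by apply: (idealMr (idJ mu)); exact: idem_off.
Qed.

(** At [mu] the factor [idem S - 1] is locally zero, and at any other grid point [g mu] is. This
    recovers [g mu] from a multiple of [idem S]. *)
Lemma idem_absorb mu : mu \in S -> ideal_gen (in_var f) (g mu * idem S - g mu).
Proof.
move=> S_mu; have in_mu := fsubsetP sub_S _ S_mu.
apply: ideal_of_local_ideals => nu in_nu.
rewrite -[X in _ - X]mulr1 -mulrBr.
have [->|ne_nu] := eqVneq nu mu; first by apply: (idealM (idJ mu)); exact: idem_at.
by apply: (idealMr (idJ nu)); exact: g_off.
Qed.

(* Modulo I, [a] is a unit on the component cut out by [idem S] and nilpotent
   on the complementary one. *)
Lemma idem_power_span (a : {mpoly k[n]}) :
  (forall lam, lam \in zero_grid f -> (lam \in S) = (a.@[lam] != 0)) ->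
  exists2 M, ideal_gen (in_var f) (a ^+ M * (1 - idem S)) &
    forall N, (M <= N)%N ->
    exists u : {poly k}, ideal_gen (in_var f) (horner_alg a u * a ^+ N - idem S).
Proof.
move=> S_E; pose I := ideal_gen (in_var f).
have idI : is_ideal I by exact: ideal_gen_ideal.
(* The grid is finite, so one exponent serves all its points. *)
have [M nilM] : exists M, forall lam, lam \in (zero_grid f : seq _) ->
    local_ideal f lam ((a - a.@[lam]%:MP) ^+ M).
  apply: max_bound => [lam m m' Jm le_m | lam _].
    exact: (idealX_leq (idJ lam)) le_m.
  by apply: nilpotent_at_zero; rewrite mevalB mevalC subrr.
have nilI : I (a ^+ M * (1 - idem S)).
  apply: ideal_of_local_ideals => lam in_lam.
  have [S_lam|S_lam] := boolP (lam \in S).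
    apply: (idealM (idJ lam)); rewrite -opprB; apply: (idealN (idJ lam)).
    exact: idem_at.
  apply: (idealMr (idJ lam)); have := nilM lam in_lam.
  by move: S_lam; rewrite S_E // negbK => /eqP ->; rewrite subr0.
(* [q] evaluated at [a] vanishes on the components in [S], while [q] itself is nonzero at 0 because
   [a] has nonzero values on [S]. Hence [q] is coprime to ['X^N]. *)
exists M => // N le_MN; pose q := \prod_(lam <- S) ('X - (a.@[lam])%:P) ^+ M.
have qI : I (idem S * horner_alg a q).
  apply: ideal_of_local_ideals => lam in_lam.
  have [S_lam|S_lam] := boolP (lam \in S); last first.
    by apply: (idealMr (idJ lam)); exact: idem_off.
  apply: (idealM (idJ lam)).
  rewrite rmorph_prod (big_fsetD1 lam) //=; apply: (idealMr (idJ lam)).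
  rewrite rmorphXn rmorphB /= horner_algX horner_algC -mul_mpolyC mulr1.
  exact: nilM.
have /Bezout_eq1_coprimepP[[u v] /= Duv] : coprimep ('X^N) q.
  rewrite coprimep_sym coprimep_expr // -['X]subr0 coprimep_XsubC /root /q.
  rewrite horner_prod prodf_seq_neq0; apply/allP => lam S_lam /=.
  rewrite horner_exp !hornerE expf_neq0 // oppr_eq0 -S_E //.
  exact: (fsubsetP sub_S).
exists u; set e := idem S; set w := horner_alg a u * a ^+ N.
have Dw : w + horner_alg a v * horner_alg a q = 1.
  by rewrite -[RHS](rmorph1 (horner_alg a)) -Duv rmorphD !rmorphM rmorphXn /= horner_algX.
(* This is [w * (1 - e) - e * (1 - w)]: the first term is in I by nilpotency off [S], the second
   because [q] at [a] kills the components in [S]. *)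
have ->: w - e =
    horner_alg a u * (a ^+ N * (1 - e)) - horner_alg a v * (e * horner_alg a q).
  have -> : horner_alg a v * (e * horner_alg a q) = e * (1 - w) by rewrite -Dw; ring.
  by rewrite /w; ring.
apply: (idealD idI); last by apply: (idealN idI); apply: (idealM idI).
apply: (idealM idI); rewrite -(subnK le_MN) exprD -mulrA.
exact: (idealM idI).
Qed.

End Subset.

Lemma MZ_space_idem (V : {pred {mpoly k[n]}}) :
  submod_closed V -> (forall p, ideal_gen (in_var f) p -> p \in V) ->
  MZ_space V <->
  (forall S : {fset {ffun 'I_n -> k}}, (S `<=` zero_grid f)%fset ->
     idem S \in V -> forall b, b * idem S \in V).
Proof.
move=> V_sub V_I; have [V0 V_lin] := V_sub.
have VZ c p : p \in V -> c *: p \in V.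
  by move=> Vp; rewrite -[c *: p]addr0; exact: V_lin.
have VD p q : p \in V -> q \in V -> p + q \in V.
  by move=> Vp Vq; rewrite -[p]scale1r; exact: V_lin.
have idI : is_ideal (ideal_gen (in_var f)) by exact: ideal_gen_ideal.
have V_mod p q : ideal_gen (in_var f) (p - q) -> q \in V -> p \in V.
  by move=> Ipq Vq; rewrite -[p](subrK q); apply: VD => //; exact: V_I.
split=> [[_ V_MZ] S sub_S Ve b|V_idem].
  have Ve_pow m : (1 <= m)%N -> idem S ^+ m \in V.
    by case: m => // m _; apply: V_mod Ve; exact: idemX.
  have [N VN] := V_MZ _ (ex_intro _ 1%N Ve_pow) b.
  (* The exponent [N.+1] is positive, as [idemX] requires. *)
  apply: V_mod (VN N.+1 (leqnSn N)); rewrite -mulrBr -opprB mulrN.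
  by apply: (idealN idI); apply: (idealM idI); exact: idemX.
split=> // a [N VaN] b.
pose S := [fset lam in zero_grid f | a.@[lam] != 0]%fset.
have sub_S : (S `<=` zero_grid f)%fset.
  by apply/fsubsetP => lam; rewrite !inE => /andP[].
have [M nilM spanM] : exists2 M, ideal_gen (in_var f) (a ^+ M * (1 - idem S)) &
    forall N, (M <= N)%N ->
    exists u : {poly k}, ideal_gen (in_var f) (horner_alg a u * a ^+ N - idem S).
  by apply: idem_power_span sub_S _ _ => lam in_lam; rewrite !inE in_lam.
have Ve : idem S \in V.
  (* [M] is needed for the span and [N] for membership in [V]; expanding [u] then gives a
     combination of powers of [a] that all lie in [V]. *)
  have [u Iu] := spanM (maxn M N) (leq_maxl _ _).
  apply: (@V_mod _ (horner_alg a u * a ^+ maxn M N)).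
    by rewrite -opprB; exact: (idealN idI).
  rewrite -[u]coefK poly_def raddf_sum mulr_suml.
  apply: (big_ind (fun p => p \in V)) => // i _ /=.
  rewrite -mul_polyC rmorphM rmorphXn /= horner_algC horner_algX.
  rewrite -scalerAl mul1r -scalerAl -exprD; apply: VZ; apply: VaN.
  by rewrite (leq_trans (leq_maxr M N)) ?leq_addl.
(* From exponent [M] on, [a ^+ m] agrees modulo I with [a ^+ m * idem S], so the threshold does not
   depend on [b]. *)
exists M => m le_Mm; apply: V_mod (V_idem S sub_S Ve (b * a ^+ m)).
have -> : b * a ^+ m - b * a ^+ m * idem S
    = b * a ^+ (m - M) * (a ^+ M * (1 - idem S)).
  by rewrite -[in LHS](subnK le_Mm) exprD; ring.
exact: (idealM idI).
Qed.

End Idempotents.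
End Grid.

(** * Translation of the criterion into conditions (i) and (ii) *)

Local Open Scope fset_scope.

Theorem theorem3 (k : closedFieldType) (char0 : [pchar k] =i pred0)
    (n : nat) (f : 'I_n -> {poly k})
    (f_monic : forall i : 'I_n, f i \is monic)
    (f_deg : forall i : 'I_n, (1 < size (f i))%N)
    (f_zeros : forall i : 'I_n, 0 \notin zeros (f i))
    (g : {ffun 'I_n -> k} -> {mpoly k[n]})
    (g_at : forall lam : {ffun 'I_n -> k}, lam \in zero_grid f ->
       local_ideal f lam (g lam - 1))
    (g_off : forall lam mu : {ffun 'I_n -> k},
       lam \in zero_grid f -> mu \in zero_grid f -> mu != lam ->
       local_ideal f mu (g lam))
    (V : {pred {mpoly k[n]}}) (V_sub : submod_closed V)
    (V_I : forall p : {mpoly k[n]}, ideal_gen (in_var f) p -> p \in V)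
    (r : nat) (V_codim : quotient_dim V r)
    (L : {linear {mpoly k[n]} -> 'rV[k]_r})
    (L_surj : forall y : 'rV[k]_r, exists p : {mpoly k[n]}, L p = y)
    (L_ker : forall p : {mpoly k[n]}, (p \in V) = (L p == 0))
    (P : 'I_r -> {ffun 'I_n -> k} -> {mpoly k[n]})
    (P_deg : forall (i : 'I_r) (lam : {ffun 'I_n -> k}),
       lam \in zero_grid f -> Deg_lt (P i lam) (mult f lam))
    (L_form : forall (i : 'I_r) (p : {mpoly k[n]}),
       L p 0 i = \sum_(lam <- zero_grid f) (euler_op (P i lam) p).@[lam]) :
  let Lam := zero_grid f in
  let Lam0 := [fset lam in Lam | g lam \in V] in
  MZ_space V <->
    (forall Lam' : {fset {ffun 'I_n -> k}}, Lam' `<=` Lam ->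
       Lam' `\` Lam0 != fset0 ->
       exists i : 'I_r,
         \sum_(lam <- Lam' `\` Lam0) (P i lam).@[fun=> 0] != 0)
    /\
    (forall Lam' : {fset {ffun 'I_n -> k}}, Lam' `<=` Lam ->
       Lam' != fset0 ->
       forall (i : 'I_r) (p : {mpoly k[n]}),
         ideal_gen (fun lam : Lam' `&` Lam0 => g (val lam)) p -> L p 0 i = 0).

Proof.
move=> Lam Lam0; have [V0 V_lin] := V_sub.
have in_Lam0 lam : (lam \in Lam0) = (lam \in Lam) && (g lam \in V).
  by rewrite !inE.
have idem_fset1 lam : idem g [fset lam] = g lam by rewrite /idem big_seq_fset1.
have L_g i lam : lam \in Lam -> L (g lam) 0 i = (P i lam).@[fun=> 0].
  move=> in_lam; rewrite L_form (big_fsetD1 lam) //= big_seq big1 => [|mu].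
    by rewrite addr0; apply: (@euler_op_local_unit _ _ lam _ (mult f lam));
      [exact: P_deg | exact: g_at].
  rewrite !inE => /andP[ne_mu in_mu].
  by apply: (@euler_op_powers_ideal _ _ mu _ (mult f mu));
    [exact: P_deg | exact: g_off in_lam in_mu ne_mu].
have L_idem i (S : {fset {ffun 'I_n -> k}}) : S `<=` Lam ->
    L (idem g S) 0 i = (\sum_(lam <- S) (P i lam).@[fun=> 0])%R.
  move=> /fsubsetP sub_S; rewrite raddf_sum summxE big_seq [RHS]big_seq.
  by apply: eq_bigr => lam /sub_S; exact: L_g.
have V_row p : p \in V <-> forall i, L p 0 i = 0.
  rewrite L_ker; split=> [/eqP -> i|Lp0]; first by rewrite mxE.
  by apply/eqP/rowP => i; rewrite Lp0 mxE.
have VD p q : p \in V -> q \in V -> (p + q)%R \in V.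
  by move=> Vp Vq; rewrite -[p]scale1r; exact: V_lin.
have subD (S T : {fset {ffun 'I_n -> k}}) : S `<=` Lam -> S `\` T `<=` Lam.
  by apply: fsubset_trans; exact: fsubsetDl.
apply: iff_trans (MZ_space_idem _ g_at g_off V_sub V_I) _ => [i|]; first exact: f_deg.
split=> [V_idem|[idem_notin gen_in] S sub_S Ve b].
  split=> [S sub_S /fset0Pn[mu S_mu]|S sub_S _ i p].
    (* If all the sums vanished, the idempotent of [S] minus [Lam0] would lie in [V]; multiplying it
       by [g mu] would put [g mu] in [V], although [mu] is outside [Lam0]. *)
    have [/existsP //|/existsPn no_i] :=
      boolP [exists i, (\sum_(lam <- S `\` Lam0) (P i lam).@[fun=> 0])%R != 0].
    have in_mu := fsubsetP (subD S Lam0 sub_S) _ S_mu.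
    have Ve : idem g (S `\` Lam0) \in V.
      by apply/V_row => i; rewrite L_idem ?subD //; apply/eqP/negPn/no_i.
    have := V_idem _ (subD S Lam0 sub_S) Ve (g mu).
    have I_mu := idem_absorb f_deg g_at g_off (subD S Lam0 sub_S) S_mu.
    move: S_mu; rewrite inE in_Lam0 in_mu /= => /andP[/negP nVg _] Vge; case: nVg.
    rewrite -[g mu](subKr (g mu * idem g (S `\` Lam0))) addrC; apply: VD => //.
    by apply: V_I; apply: (idealN (ideal_gen_ideal _)).
  move=> gen_p; apply/V_row: i; case: gen_p => h ->.
  apply: (big_ind (fun q => q \in V)) => // lam _.
  have: val lam \in S `&` Lam0 by exact: valP.
  rewrite inE in_Lam0 => /andP[_ /andP[in_lam Vg]].
  (* The criterion for a singleton puts every multiple of a generator in [V]. *)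
  by rewrite -idem_fset1; apply: V_idem; rewrite ?fsub1set ?idem_fset1.
(* Condition (ii) for the whole grid suffices here. *)
have gV lam : lam \in Lam0 -> forall c, c * g lam \in V.
  move=> in_lam c; apply/V_row => i.
  have in_lam' : lam \in Lam `&` Lam0.
    by move: in_lam; rewrite inE in_Lam0 => /andP[-> ->].
  apply: (gen_in Lam) => //.
    by apply/fset0Pn; exists lam; move: in_lam; rewrite in_Lam0 => /andP[].
  apply: (idealM (ideal_gen_ideal _)).
  exact: (ideal_gen_mem (fun mu : Lam `&` Lam0 => g (val mu)) [` in_lam']).
have V_sum (T : {fset {ffun 'I_n -> k}}) c : T `<=` Lam0 -> c * idem g T \in V.
  move=> /fsubsetP sub_T; rewrite /idem mulr_sumr big_seq.
  by apply: (big_ind (fun q => q \in V)) => // lam /sub_T /gV.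
(* Both [idem g S] and its part over [Lam0] lie in [V], hence so does the part outside [Lam0]. All
   coordinates of [L] vanish on it, which (i) forbids unless that part is empty. *)
have S_Lam0 : S `\` Lam0 == fset0.
  apply/negPn/negP => /(idem_notin S sub_S)[i /eqP[]].
  rewrite -L_idem ?subD //; apply/V_row: i.
  have -> : idem g (S `\` Lam0) = (-1 *: idem g (S `&` Lam0) + idem g S)%R.
    by rewrite scaleN1r (idem_split g S Lam0) addKr.
  by apply: V_lin => //; rewrite -[idem _ _]mul1r; apply: V_sum; exact: fsubsetIr.
by apply: V_sum; rewrite -fsetD_eq0.
Qed.
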